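(* Let $(X,d)$ be a compact metric space containing at least two points and let $f:X\to X$ be a continuous map. If $f$ has average shadowing, then $f$ has mean ergodic shadowing.
   Context: $\mathbb{N}$ denotes the set of non-negative integers. A set $E\subset\mathbb{N}$ has density zero if $\lim_{n\to\infty}\frac{1}{n}\#(E\cap\{0,1,\dots,n-1\})=0$. A sequence $\{x_i\}_{i\in\mathbb{N}}$ in $X$ is $\epsilon$-shadowed in average by $x\in X$ if $\limsup_{n\to\infty}\frac1n\sum_{i=0}^{n-1}d(f^i(x),x_i)<\epsilon$. Average shadowing: $\{x_i\}_{i\in\mathbb{N}}$ is a $\delta$-average pseudo orbit for $f$ if there is $N\in\mathbb{N}$ such that for every $n\ge N$ (with $n\ge1$) and every non-negative integer $k$, $\frac1n\sum_{i=0}^{n-1}d(f(x_{i+k}),x_{i+k+1})<\delta$. The map $f$ has average shadowing if for every $\epsilon>0$ there is $\delta>0$ such that every $\delta$-average pseudo orbit is $\epsilon$-shadowed in average by some point of $X$. Mean ergodic shadowing: $\{x_i\}_{i\in\mathbb{N}}$ is a $\delta$-ergodic pseudo orbit for $f$ if the set $\{i\in\mathbb{N}: d(f(x_i),x_{i+1})\ge\delta\}$ has density zero. The map $f$ has mean ergodic shadowing if for every $\epsilon>0$ there is $\delta>0$ such that every $\delta$-ergodic pseudo orbit is $\epsilon$-shadowed in average by some point of $X$. *)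

(* Defs.v *)
From HB Require Import structures.
From mathcomp Require Import all_boot all_order all_algebra.
From mathcomp Require Import all_classical all_reals all_analysis.
Set Implicit Arguments.
Unset Strict Implicit.
Unset Printing Implicit Defensive.
Import Order.TTheory GRing.Theory Num.Theory.
Import numFieldNormedType.Exports.

Local Open Scope classical_set_scope.
Local Open Scope ring_scope.

Definition density_zero (R : realType) (E : set nat) : Prop :=
  (fun n : nat => n%:R^-1 * #|[pred i : 'I_n | (i : nat) \in E]|%:R : R)
    @ \oo --> (0 : R).

Section shadowing.
Context {R : realType} {X : metricType R}.
Implicit Types (f : X -> X) (u : nat -> X) (x : X) (eps delta : R).

(* The limsup is taken in \bar R, where it exists for every real sequence; the
   term n = 0, in which 0^-1 = 0, does not affect it. *)
Definition shadowed_in_average f eps u x : Prop :=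
  (limn_esup (fun n : nat =>
     (n%:R^-1 * \sum_(i < n) mdist (iter i f x) (u i))%:E) < eps%:E)%E.

Definition average_pseudo_orbit f delta u : Prop :=
  exists N : nat, forall n k : nat, (N <= n)%N -> (1 <= n)%N ->
    n%:R^-1 * \sum_(i < n) mdist (f (u (i + k)%N)) (u (i + k).+1%N) < delta.

Definition average_shadowing f : Prop :=
  forall eps, 0 < eps -> exists2 delta, 0 < delta &
    forall u, average_pseudo_orbit f delta u ->
      exists x, shadowed_in_average f eps u x.

Definition ergodic_pseudo_orbit f delta u : Prop :=
  density_zero R [set i | delta <= mdist (f (u i)) (u i.+1)].

Definition mean_ergodic_shadowing f : Prop :=
  forall eps, 0 < eps -> exists2 delta, 0 < delta &
    forall u, ergodic_pseudo_orbit f delta u ->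
      exists x, shadowed_in_average f eps u x.

End shadowing.

(* Main.v *)
Require Import Defs.
From HB Require Import structures.
From mathcomp Require Import all_boot all_order all_algebra.
From mathcomp Require Import all_classical all_reals all_analysis.
From mathcomp Require Import zify lra.
Import Order.TTheory GRing.Theory Num.Theory.
Import numFieldNormedType.Exports.

Local Open Scope classical_set_scope.
Local Open Scope ring_scope.

(** Average shadowing controls the error of a pseudo orbit uniformly over all
    windows of indices, whereas a set of density zero may still contain
    arbitrarily long intervals; so an ergodic pseudo orbit [u] need not be an
    average pseudo orbit.  It becomes one after a change on a set of density
    zero, and such a change does not affect average shadowing, because the
    metric of a compact space is bounded, say by [D].

    The change is made as follows.  Cut the indices into blocks of length [M].
    Follow [u] from the beginning of each block until [u] makes a bad jump,
    that is, one of size at least [delta / 4]; from there on follow the true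
    orbit of [f], up to the end of the block, where [u] is resumed.  The new
    sequence [y = repair f u bad M] has two features.
    - Its jumps have size less than [delta / 4], except possibly those from one
      block to the next.  A window of length [n] contains at most [n / M + 1]
      of the latter, so if [D / M <= delta / 4] and [n >= M] the average jump
      is at most [3 delta / 4] ([repair_average_pseudo_orbit]).
    - A bad jump spoils at most the rest of its block, so among the first [n]
      indices [y] differs from [u] at most [M] times as often as [u] makes a bad
      jump ([repair_neq_count]); this is a set of density zero.
    A point that shadows [y] in average therefore shadows [u] in average
    ([shadowed_in_average_change]). *)

(** Near each point the distance to a fixed [p] stays below every large enough
    [C]; compactness makes [C] uniform, and the diameter is at most [2 C]. *)
Lemma compact_mdist_bounded (R : realType) (X : metricType R) :
  compact [set: X] -> exists2 D : R, 0 <= D & forall x y : X, mdist x y <= D.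
Proof.
move=> /compact_near_coveringP Xc.
have [[p _]|X0] := pselect (exists p : X, True); last first.
  by exists 0 => // x; case: X0; exists x.
have /filter_ex[C pC] : \forall C \near (+oo : set_system R),
    [set: X] `<=` [set x | mdist p x <= C].
  apply: (Xc R +oo (fun C x => mdist p x <= C)) => x _.
  exists (ball x 1, [set C : R | mdist p x + 1 < C]) => /=.
    by split; [exact: nbhsx_ballx | apply: nbhs_pinfty_gt; exact: num_real].
  case=> y C /= [xy pxC]; move: xy; rewrite ballEmdist/= => xy.
  have := metric_triangle p x y; lra.
exists (C + C) => [|x y].
  by have := pC p I; rewrite /= mdistxx => ?; lra.
have := metric_triangle x p y; have := pC x I; have := pC y I.
rewrite /= (metric_sym x p); lra.
Qed.

(** A strict bound on the upper limit leaves room: it amounts to a smaller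
    bound that holds eventually.  In this form a null sequence is absorbed. *)
Lemma limn_esup_ltP (R : realType) (a : nat -> R) (e : R) :
  (limn_esup (fun n => (a n)%:E) < e%:E)%E <->
  exists2 c, c < e & \forall n \near \oo, a n <= c.
Proof.
split=> [/ereal_inf_lt[_ [V Voo <-]]|[c ce ac]]; last first.
  apply: (@le_lt_trans _ _ c%:E); last by rewrite lte_fin.
  apply: ge_ereal_inf.
  exists (ereal_sup ((fun n => (a n)%:E) @` [set n | a n <= c])).
    by exists [set n | a n <= c].
  by apply: ge_ereal_sup => _ [n /= anc <-]; rewrite lee_fin.
set s := ereal_sup _ => se.
have aV n : V n -> ((a n)%:E <= s)%E.
  by move=> Vn; apply: ereal_sup_ubound; exists n.
case: s se aV => [r||] //=; first rewrite lte_fin.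
- by move=> re aV; exists r => //; near=> n; have := aV n; rewrite lee_fin; apply; near: n.
- move=> _ aV; exists (e - 1); first by lra.
  by near=> n; suff /aV : V n by []; near: n.
Unshelve. all: by end_near.
Qed.

Definition count_upto (P : pred nat) (n : nat) : nat := (\sum_(i < n) P i)%N.

Lemma density_zeroE (R : realType) (P : pred nat) :
  density_zero R [set i | P i] <->
  (fun n : nat => n%:R^-1 * (count_upto P n)%:R : R) @ \oo --> (0 : R).
Proof.
suff -> : count_upto P = fun n => #|[pred i : 'I_n | (i : nat) \in [set i | P i]]|.
  by [].
apply/funext => n; rewrite /count_upto -sum1_card [RHS]big_mkcond/=.
apply: eq_bigr => i _; rewrite inE/=.
by rewrite (_ : (_ \in _) = P i); [case: (P i) | apply/idP/idP; rewrite in_setE].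
Qed.

(** The sets are compared by their counts, so that one point of [P] can pay for
    up to [M] points of [Q] that come after it. *)
Lemma density_zero_count_le (R : realType) (P Q : pred nat) (M : nat) :
  (forall n, (count_upto Q n <= M * count_upto P n)%N) ->
  density_zero R [set i | P i] -> density_zero R [set i | Q i].
Proof.
move=> QP /density_zeroE P0; apply/density_zeroE.
apply: (@squeeze_cvgr _ _ _ _ (cst 0)
    (fun n : nat => M%:R * (n%:R^-1 * (count_upto P n)%:R))).
- near=> n; rewrite mulr_ge0//= mulrCA ler_wpM2l//.
  by rewrite -natrM ler_nat.
- exact: cvg_cst.
- by rewrite -[X in _ --> X](mulr0 M%:R); apply: cvgM => //; exact: cvg_cst.
Unshelve. all: by end_near.
Qed.

(** Where the two sequences differ the distance to the orbit changes by at most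
    the diameter [D], which contributes nothing to the average in the limit. *)
Lemma shadowed_in_average_change (R : realType) (X : metricType R) (f : X -> X)
    (D eps : R) (u y : nat -> X) (x : X) :
  (forall a b : X, mdist a b <= D) ->
  density_zero R [set i | y i != u i] ->
  shadowed_in_average f eps y x -> shadowed_in_average f eps u x.
Proof.
move=> XD /density_zeroE yu /limn_esup_ltP[c ce yc].
have D0 : 0 <= D by rewrite -(mdistxx x).
apply/limn_esup_ltP; exists ((c + eps) / 2); first by lra.
have : (fun n : nat => D * (n%:R^-1 * (count_upto (fun i => y i != u i) n)%:R))
    @ \oo --> (0 : R).
  by rewrite -[X in _ --> X](mulr0 D); apply: cvgM => //; exact: cvg_cst.
have ce2 : 0 < (eps - c) / 2 by lra.
move=> /cvgrPdist_le /(_ _ ce2) small.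
near=> n.
have : `|0 - D * (n%:R^-1 * (count_upto (fun i => y i != u i) n)%:R)|
    <= (eps - c) / 2 by near: n.
rewrite sub0r normrN => /(le_trans (ler_norm _)) small_n.
have yc_n : n%:R^-1 * (\sum_(i < n) mdist (iter i f x) (y i)) <= c by near: n.
apply: (@le_trans _ _ (n%:R^-1 * (\sum_(i < n) mdist (iter i f x) (y i)) +
  D * (n%:R^-1 * (count_upto (fun i => y i != u i) n)%:R))); last by lra.
rewrite mulrCA -mulrDr ler_wpM2l// /count_upto natr_sum mulr_sumr -big_split/=.
apply: ler_sum => i _; case: eqVneq => [->|_]; first by rewrite mulr0 addr0.
rewrite mulr1; have := XD (iter i f x) (u i).
by have := mdist_ge0 (iter i f x) (y i); lra.
Unshelve. all: by end_near.
Qed.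

(** The test [y == u j] records whether a bad jump has already occurred in the
    current block, so that no second state variable is needed; if the orbit of
    [f] happens to meet [u] again, following [u] is harmless. *)
Fixpoint repair (X : eqType) (f : X -> X) (u : nat -> X) (bad : pred nat)
    (M i : nat) : X :=
  if i is j.+1 then
    let y := repair X f u bad M j in
    if (M %| j.+1)%N || (y == u j) && ~~ bad j then u j.+1 else f y
  else u 0.

(** The second summand on the left makes the induction work: it counts the
    indices that remain in the block of [n], all of which a bad jump before [n]
    may spoil. *)
Lemma repair_neq_potential (X : eqType) (f : X -> X) (u : nat -> X)
    (bad : pred nat) (M n : nat)
    (neq := fun i => repair X f u bad M i != u i) : (0 < M)%N ->
  (count_upto neq n + neq n * (M - n %% M) <= M * count_upto bad n)%N.
Proof.
move=> M0; rewrite /count_upto.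
elim: n => [|n IH]; first by rewrite !big_ord0 /neq /= eqxx.
rewrite !big_ord_recr/= mulnDr.
have nM := ltn_pmod n M0.
have step : neq n.+1 -> ~~ (M %| n.+1)%N /\ (neq n || bad n).
  rewrite /neq /=; case: (M %| n.+1)%N => /=; first by rewrite eqxx.
  case: (repair _ _ _ _ _ _ == u n) => //=.
  by case: (bad n) => //=; rewrite eqxx.
case En1 : (neq n.+1); last first.
  by case: (neq n) IH => /= IH; lia.
have [/negPf nd] := step En1.
rewrite modnS nd; case: (neq n) IH => /= IH; last by move=> ->; lia.
by move=> _; lia.
Qed.

Lemma repair_neq_count (X : eqType) (f : X -> X) (u : nat -> X)
    (bad : pred nat) (M n : nat) : (0 < M)%N ->
  (count_upto (fun i => repair X f u bad M i != u i) n
     <= M * count_upto bad n)%N.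
Proof.
by move=> M0; apply: leq_trans (repair_neq_potential X f u bad M n M0);
  exact: leq_addr.
Qed.

(** Up to the difference of the residues at the two ends of the window, each
    multiple of [M] accounts for exactly [M] indices. *)
Lemma count_multiples (M k n : nat) : (0 < M)%N ->
  (M * (count_upto (fun i => M %| (i + k).+1) n) <= n + M)%N.
Proof.
move=> M0; have kM := ltn_pmod k M0.
suff : (M * (count_upto (fun i => M %| (i + k).+1) n) + (n + k) %% M =
        n + k %% M)%N by lia.
rewrite /count_upto; elim: n => [|n IH]; first by rewrite big_ord0 muln0.
rewrite big_ord_recr/= mulnDr addSn modnS.
case: ifPn => [dvd|_]; last by rewrite muln0 addn0 addnS IH addSn.
(* the residue before a multiple of [M] is [M - 1] *)
suff eM : ((n + k) %% M).+1 = M.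
  by rewrite muln1 addn0 -[X in (_ + X)%N]eM addnS IH addSn.
have := ltn_pmod (n + k) M0; rewrite leq_eqVlt => /orP[/eqP//|lt].
by move: dvd; rewrite /dvdn -addn1 -modnDml addn1 modn_small.
Qed.

(** In a window of length [n >= M] the small jumps contribute at most
    [n delta / 4] and the block boundaries at most
    [D (n + M) / M <= 2 n delta / 4]. *)
Lemma repair_average_pseudo_orbit (R : realType) (X : metricType R)
    (f : X -> X) (D delta : R) (u : nat -> X) (M : nat) :
  (forall a b : X, mdist a b <= D) -> 0 <= D -> 0 < delta -> (0 < M)%N ->
  D <= delta / 4 * M%:R ->
  let bad := fun i => delta / 4 <= mdist (f (u i)) (u i.+1) in
  average_pseudo_orbit f delta (repair X f u bad M).
Proof.
move=> XD D0 d0 M0 DM bad; exists M => n k Mn n0.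
have jump i : mdist (f (repair X f u bad M i)) (repair X f u bad M i.+1)
    <= delta / 4 + D * (M %| i.+1)%:R.
  rewrite [repair _ _ _ _ _ i.+1]/=; case: (M %| i.+1)%N => /=.
    by rewrite mulr1; have := XD (f (repair X f u bad M i)) (u i.+1); lra.
  rewrite mulr0 addr0; case: ifPn => [/andP[/eqP ->]|_].
    by rewrite /bad -ltNge => /ltW.
  by rewrite mdistxx; lra.
have nR : (0 : R) < n%:R by rewrite ltr0n.
rewrite mulrC ltr_pdivrMr//.
apply: (@le_lt_trans _ _ (delta / 4 * n%:R +
  D * (count_upto (fun i => M %| (i + k).+1)%N n)%:R)).
  apply: (@le_trans _ _
    (\sum_(i < n) (delta / 4 + D * (M %| (i + k).+1)%:R))).
    by apply: ler_sum => i _; exact: jump.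
  rewrite big_split/= sumr_const card_ord /count_upto natr_sum.
  by rewrite mulr_sumr mulr_natr.
set c := count_upto _ n.
apply: (@le_lt_trans _ _ (delta / 4 * n%:R + delta / 4 * (M * c)%:R)).
  by rewrite lerD2l natrM mulrA ler_wpM2r.
apply: (@le_lt_trans _ _ (delta / 4 * n%:R + delta / 4 * (n + n)%:R)).
  rewrite lerD2l ler_wpM2l ?ler_nat//; first by lra.
  by apply: leq_trans (count_multiples M k n M0) _; rewrite leq_add2l.
by rewrite natrD; have := mulr_gt0 d0 nR; lra.
Qed.

Theorem proposition3p12 (R : realType) (X : metricType R) (f : X -> X)
  (Xcompact : compact [set: X]) (Xtwo_points : exists x y : X, x <> y)
  (fcont : continuous f) :
  average_shadowing f -> mean_ergodic_shadowing f.
Proof.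
move=> fshadow eps /fshadow[delta d0 shadow].
have [D D0 XD] := compact_mdist_bounded R X Xcompact.
have d4 : 0 < delta / 4 by lra.
exists (delta / 4) => // u bad0.
pose M := (Num.truncn (D / (delta / 4))).+1.
have DM : D <= delta / 4 * M%:R.
  by rewrite mulrC -ler_pdivrMr// ltW// /M truncnS_gt.
have [x xy] := shadow _ (repair_average_pseudo_orbit R X f D delta u M XD D0 d0
  (ltn0Sn _) DM).
exists x; apply: shadowed_in_average_change XD _ xy.
apply: density_zero_count_le bad0 => n.
exact: repair_neq_count.
Qed.
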